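(* The problem Delay is undecidable.
   Context: Temporal Datalog. Constants are partitioned into objects and integer time points; variables into object variables and time variables. A time term is a time point, a time variable, or an expression $t+k$ with $t$ a time variable and $k\in\mathbb{Z}$. Each predicate is either extensional (EDB) or intensional (IDB) and has an arity $n\ge0$, each position being of object sort or time sort; a predicate is rigid if all its positions are of object sort, and temporal if its last position is of time sort and all others are of object sort. An atom $P(t_1,\dots,t_n)$ has terms of the required sorts. A rule is $\bigwedge_i\alpha_i\to\alpha$ with $\alpha$ and all $\alpha_i$ rigid or temporal atoms, $\alpha$ IDB whenever the body is nonempty, and every head variable occurring in the body. A program is a finite set of rules. A fact is a ground rigid or temporal atom without $+$ (identified with the rule $\top\to\alpha$); a dataset is a finite set of EDB facts. Rules are read as universally quantified first-order sentences with $+$ interpreted as integer addition; $\Pi\models\alpha$ denotes entailment. A query is $Q=\langle P_Q,\Pi_Q\rangle$ with $\Pi_Q$ a program and $P_Q$ an IDB predicate of $\Pi_Q$; it is temporal if $P_Q$ is temporal. For a temporal query $Q$, dataset $D$ and time point $\tau$, $Q(D,\tau)$ is the set of tuples of objects $\vec o$ with $\Pi_Q\cup D\models P_Q(\vec o,\tau)$. A $\tau_{in}$-history is a dataset consisting of rigid facts and temporal facts with time argument $\le\tau_{in}$; a $\tau_{in}$-update is a dataset consisting of temporal facts with time argument $>\tau_{in}$. Delay: an instance is $\langle Q,d\rangle$ with $Q$ a temporal query and $d$ a nonnegative integer; Delay holds for it iff $Q(D,\tau_{in}-d)=Q(D\cup U,\tau_{in}-d)$ for every time point $\tau_{in}$,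 every $\tau_{in}$-history $D$ and every $\tau_{in}$-update $U$. *)

(* Defs.v *)
(* Temporal Datalog, the Delay problem, and a concrete model of
   computation (mu-recursive functions on nat) with a fixed Goedel encoding of
   Delay instances, so that "undecidable" can be stated non-trivially. *)
From Stdlib Require Import List ZArith Arith.
Import ListNotations.
Open Scope Z_scope.

Inductive sort := SObj | STime.

(* A predicate: a name, whether it is intensional (IDB = true) or extensional,
   and the sorts of its positions (hence its arity). *)
Record pred := MkPred { pid : nat; pidb : bool; psorts : list sort }.

Definition rigid (p : pred) : Prop := Forall (fun s => s = SObj) (psorts p).
Definition temporal (p : pred) : Prop :=
  exists l, psorts p = l ++ [STime] /\ Forall (fun s => s = SObj) l.

Inductive term :=
| TObj (c : nat)
| TOVar (x : nat)
| TTime (z : Z)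
| TTVar (x : nat)
| TTPlus (x : nat) (k : Z).

Definition term_sort (t : term) : sort :=
  match t with TObj _ | TOVar _ => SObj | _ => STime end.

Record atom := MkAtom { apred : pred; aargs : list term }.

Definition well_sorted (a : atom) : Prop :=
  map term_sort (aargs a) = psorts (apred a).

Definition rt_atom (a : atom) : Prop :=
  well_sorted a /\ (rigid (apred a) \/ temporal (apred a)).

Definition term_vars (t : term) : list (sort * nat) :=
  match t with
  | TOVar x => [(SObj, x)]
  | TTVar x | TTPlus x _ => [(STime, x)]
  | _ => []
  end.
Definition atom_vars (a : atom) : list (sort * nat) :=
  flat_map term_vars (aargs a).

Record rule := MkRule { body : list atom; head : atom }.

Definition wf_rule (r : rule) : Prop :=
  rt_atom (head r) /\ Forall rt_atom (body r) /\
  (body r <> [] -> pidb (apred (head r)) = true) /\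
  (forall v, In v (atom_vars (head r)) -> exists b, In b (body r) /\ In v (atom_vars b)).

Definition program := list rule.
Definition wf_program (P : program) : Prop := Forall wf_rule P.

Definition ground_term (t : term) : Prop :=
  match t with TObj _ | TTime _ => True | _ => False end.
Definition is_fact (a : atom) : Prop := rt_atom a /\ Forall ground_term (aargs a).
Definition fact_rule (a : atom) : rule := MkRule [] a.

Definition dataset := list atom.
Definition is_dataset (D : dataset) : Prop :=
  Forall (fun a => is_fact a /\ pidb (apred a) = false) D.

Section Sem.
Variable Dom : Type.
Variable objc : nat -> Dom.
Variable rel : pred -> list (Dom + Z) -> Prop.

Definition eval_term (ov : nat -> Dom) (tv : nat -> Z) (t : term) : Dom + Z :=
  match t with
  | TObj c => inl (objc c)
  | TOVar x => inl (ov x)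
  | TTime z => inr z
  | TTVar x => inr (tv x)
  | TTPlus x k => inr (tv x + k)
  end.

Definition holds (ov : nat -> Dom) (tv : nat -> Z) (a : atom) : Prop :=
  rel (apred a) (map (eval_term ov tv) (aargs a)).

Definition sat_rule (r : rule) : Prop :=
  forall ov tv, (forall b, In b (body r) -> holds ov tv b) -> holds ov tv (head r).
End Sem.

Definition entails (P : program) (a : atom) : Prop :=
  forall (Dom : Type) (objc : nat -> Dom) (rel : pred -> list (Dom + Z) -> Prop),
    (forall r, In r P -> sat_rule Dom objc rel r) ->
    forall ov tv, holds Dom objc rel ov tv a.

Record query := MkQuery { qpred : pred; qprog : program }.

Definition pred_of_program (p : pred) (P : program) : Prop :=
  exists r, In r P /\ (apred (head r) = p \/ exists b, In b (body r) /\ apred b = p).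

Definition temporal_query (Q : query) : Prop :=
  wf_program (qprog Q) /\ pidb (qpred Q) = true /\
  pred_of_program (qpred Q) (qprog Q) /\ temporal (qpred Q).

Definition in_answer (Q : query) (D : dataset) (tau : Z) (o : list nat) : Prop :=
  length o = Nat.pred (length (psorts (qpred Q))) /\
  entails (qprog Q ++ map fact_rule D) (MkAtom (qpred Q) (map TObj o ++ [TTime tau])).

Definition history (tau_in : Z) (D : dataset) : Prop :=
  is_dataset D /\
  Forall (fun a => rigid (apred a) \/
     (temporal (apred a) /\ exists l z, aargs a = l ++ [TTime z] /\ z <= tau_in)) D.

Definition update (tau_in : Z) (U : dataset) : Prop :=
  is_dataset U /\
  Forall (fun a => temporal (apred a) /\
     exists l z, aargs a = l ++ [TTime z] /\ tau_in < z) U.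

Definition Delay (Q : query) (d : nat) : Prop :=
  forall (tau_in : Z) (D U : dataset), history tau_in D -> update tau_in U ->
    forall o : list nat,
      in_answer Q D (tau_in - Z.of_nat d) o <-> in_answer Q (D ++ U) (tau_in - Z.of_nat d) o.

Inductive recf :=
| rZero
| rSucc
| rProj (i : nat)
| rComp (f : recf) (gs : list recf)
| rPrec (f g : recf)
| rMu (f : recf).

Inductive reval : recf -> list nat -> nat -> Prop :=
| ev_zero v : reval rZero v 0
| ev_succ v : reval rSucc v (S (nth 0 v 0%nat))
| ev_proj i v : reval (rProj i) v (nth i v 0%nat)
| ev_comp f gs v ws y :
    Forall2 (fun g w => reval g v w) gs ws -> reval f ws y -> reval (rComp f gs) v y
| ev_prec0 f g rest y : reval f rest y -> reval (rPrec f g) (0%nat :: rest) y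
| ev_precS f g n rest z y :
    reval (rPrec f g) (n :: rest) z -> reval g (n :: z :: rest) y ->
    reval (rPrec f g) (S n :: rest) y
| ev_mu f v n :
    reval f (n :: v) 0 ->
    (forall m, (m < n)%nat -> exists k, reval f (m :: v) (S k)) ->
    reval (rMu f) v n.

Definition cp (a b : nat) : nat := ((a + b) * (a + b + 1) / 2 + b)%nat.
Definition enc_list {A} (e : A -> nat) (l : list A) : nat :=
  fold_right (fun x acc => S (cp (e x) acc)) 0%nat l.
Definition enc_bool (b : bool) : nat := if b then 1%nat else 0%nat.
Definition enc_sort (s : sort) : nat := match s with SObj => 0%nat | STime => 1%nat end.
Definition enc_Z (z : Z) : nat :=
  match z with
  | Z0 => 0%nat
  | Zpos p => (2 * Pos.to_nat p)%nat
  | Zneg p => (2 * Pos.to_nat p - 1)%nat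
  end.
Definition enc_pred (p : pred) : nat :=
  cp (pid p) (cp (enc_bool (pidb p)) (enc_list enc_sort (psorts p))).
Definition enc_term (t : term) : nat :=
  match t with
  | TObj c => cp 0 c
  | TOVar x => cp 1 x
  | TTime z => cp 2 (enc_Z z)
  | TTVar x => cp 3 x
  | TTPlus x k => cp 4 (cp x (enc_Z k))
  end.
Definition enc_atom (a : atom) : nat :=
  cp (enc_pred (apred a)) (enc_list enc_term (aargs a)).
Definition enc_rule (r : rule) : nat :=
  cp (enc_list enc_atom (body r)) (enc_atom (head r)).
Definition enc_instance (Q : query) (d : nat) : nat :=
  cp (cp (enc_pred (qpred Q)) (enc_list enc_rule (qprog Q))) d.

Definition decides_Delay (f : recf) : Prop :=
  forall (Q : query) (d : nat), temporal_query Q ->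
    (Delay Q d -> reval f [enc_instance Q d] 0%nat) /\
    (~ Delay Q d -> reval f [enc_instance Q d] 1%nat).

(* Main.v *)
(* Suppose that [f] decides Delay.  Mirroring the defining equations of a recursive
   function [h] by Datalog rules gives a program that computes [h] on every finite initial
   segment of the numbers supplied by the data through [pZero] and [pSucc].  The data may
   be wrong only in that one object serves as a numeral for two different numbers; the
   time line makes this detectable without negation, since [pNum x t] and [pAbove x t]
   together express it.  The goal is derived at [t] from [pTick t] if the data is
   ambiguous, and from [pTick t] and [pTick (t + 1)] if [h] maps the input to 0.  Only an
   update can supply [pTick (t + 1)], and updates cannot change the rigid data, so delay 0
   fails exactly when [h] maps the input to 0.  The input is the constant of a single fact
   of the program, hence encoding an instance is simple arithmetic in the input, and one may
   choose [h] to be [f] on the instance obtained by feeding [h]'s own rules, encoded, to [h]. *)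
Require Import Defs.
From Stdlib Require Import List ZArith Arith.
From Stdlib Require Import Lia Cantor Classical.
Import ListNotations.
Local Open Scope nat_scope.

(** * Recursive functions *)

(** The case of [rComp] needs the hypothesis for every member of [gs]; an inner induction on that
    list supplies it. *)
Lemma recf_nested_ind (P : recf -> Prop) :
  P rZero -> P rSucc -> (forall i, P (rProj i)) ->
  (forall f gs, P f -> Forall P gs -> P (rComp f gs)) ->
  (forall f g, P f -> P g -> P (rPrec f g)) ->
  (forall f, P f -> P (rMu f)) ->
  forall f, P f.
Proof.
  intros H0 HS Hproj Hcomp Hprec Hmu.
  fix IH 1. intros [| | i | f gs | f g | f].
  - exact H0.
  - exact HS.
  - apply Hproj.
  - apply Hcomp; [apply IH |].
    induction gs as [| g gs IHgs]; constructor; [apply IH | exact IHgs].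
  - apply Hprec; apply IH.
  - apply Hmu, IH.
Qed.

(** Evaluations also sit inside [Forall2] and under the existential of [ev_mu]; the fixpoint on the
    derivation recurses into both. *)
Lemma reval_nested_ind (P : recf -> list nat -> nat -> Prop) :
  (forall v, P rZero v 0) ->
  (forall v, P rSucc v (S (nth 0 v 0))) ->
  (forall i v, P (rProj i) v (nth i v 0)) ->
  (forall f gs v ws y, Forall2 (fun g w => P g v w) gs ws -> P f ws y ->
     P (rComp f gs) v y) ->
  (forall f g rest y, P f rest y -> P (rPrec f g) (0 :: rest) y) ->
  (forall f g n rest z y, P (rPrec f g) (n :: rest) z ->
     P g (n :: z :: rest) y -> P (rPrec f g) (S n :: rest) y) ->
  (forall f v n, P f (n :: v) 0 ->
     (forall m, m < n -> exists k, P f (m :: v) (S k)) -> P (rMu f) v n) ->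
  forall f v y, reval f v y -> P f v y.
Proof.
  intros H0 HS Hproj Hcomp Hprec0 HprecS Hmu.
  fix IH 4. intros f v y [v' | v' | i v' | f' gs v' ws y' Hgs Hf | f' g rest y' Hf
    | f' g n rest z y' Hz Hg | f' v' n Hf Hlt].
  - apply H0.
  - apply HS.
  - apply Hproj.
  - apply Hcomp with ws; [| apply IH, Hf].
    clear Hf. induction Hgs as [| g w gs ws Hg _ IHgs].
    + constructor.
    + constructor; [apply IH, Hg | apply IHgs].
  - apply Hprec0, IH, Hf.
  - apply HprecS with z; apply IH; assumption.
  - apply Hmu; [apply IH, Hf |].
    intros m Hm. destruct (Hlt m Hm) as [k Hk]. exists k. apply IH, Hk.
Qed.

(** The delicate case is minimisation: of two different results, the smaller would have to give both
    0 and a successor. *)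
Lemma reval_det f v y : reval f v y -> forall y', reval f v y' -> y = y'.
Proof.
  revert f v y. apply (reval_nested_ind (fun f v y => forall y', reval f v y' -> y = y')).
  - intros v y' H; inversion H; reflexivity.
  - intros v y' H; inversion H; reflexivity.
  - intros i v y' H; inversion H; reflexivity.
  - intros f gs v ws y Hgs Hf y' H.
    inversion H as [| | | ? ? ? ws' ? Hgs' Hf' | | |]; subst.
    apply Hf. replace ws with ws'; [exact Hf' |].
    clear - Hgs Hgs'. revert ws' Hgs'.
    induction Hgs as [| g w gs ws Hg _ IH]; intros ws' H; inversion H; subst.
    + reflexivity.
    + f_equal; [symmetry |]; auto.
  - intros f g rest y Hf y' H; inversion H; subst; auto.
  - intros f g n rest z y Hz Hg y' H.
    inversion H as [| | | | | ? ? ? ? z' ? Hz' Hg' |]; subst.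
    apply Hz in Hz'. subst z'. auto.
  - intros f v n H0 Hlt n' H.
    inversion H as [| | | | | | ? ? ? H0' Hlt']; subst.
    destruct (Nat.lt_trichotomy n n') as [L | [E | L]]; [| exact E |].
    + destruct (Hlt' n L) as [k Hk]. apply H0 in Hk. discriminate.
    + destruct (Hlt n' L) as [k Hk]. apply Hk in H0'. discriminate.
Qed.

(** * Computing the encoding *)

(** Identification with the Cantor pairing, whose inverse [of_nat] yields injectivity. *)
Lemma cp_to_nat a b : cp a b = to_nat (a, b).
Proof.
  unfold cp. pose proof (to_nat_spec a b) as H.
  enough ((a + b) * (a + b + 1) / 2 = to_nat (a, b) - b) by nia.
  symmetry. apply Nat.div_unique_exact; nia.
Qed.

Lemma cp_inj a b c d : cp a b = cp c d -> a = c /\ b = d.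
Proof.
  rewrite !cp_to_nat. intros H.
  apply (f_equal of_nat) in H. rewrite !cancel_of_to in H. now injection H.
Qed.

Fixpoint rconst (c : nat) : recf :=
  match c with
  | 0 => rZero
  | S c => rComp rSucc [rconst c]
  end.

Lemma reval_comp1 f g v w y : reval g v w -> reval f [w] y -> reval (rComp f [g]) v y.
Proof. intros. apply ev_comp with [w]; auto. Qed.

Lemma reval_comp2 f g1 g2 v w1 w2 y :
  reval g1 v w1 -> reval g2 v w2 -> reval f [w1; w2] y -> reval (rComp f [g1; g2]) v y.
Proof. intros. apply ev_comp with [w1; w2]; auto. Qed.

Lemma reval_succ1 w : reval rSucc [w] (S w).
Proof. apply (ev_succ [w]). Qed.

Lemma reval_const c v : reval (rconst c) v c.
Proof.
  induction c; simpl.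
  - constructor.
  - eapply reval_comp1; [exact IHc | apply reval_succ1].
Qed.

Definition rplus : recf := rPrec (rProj 0) (rComp rSucc [rProj 1]).

Lemma reval_plus a b : reval rplus [a; b] (a + b).
Proof.
  unfold rplus. induction a; simpl.
  - constructor. apply (ev_proj 0 [b]).
  - econstructor; [exact IHa |].
    eapply reval_comp1; [apply ev_proj | apply reval_succ1].
Qed.

(** Triangular numbers by recursion, which avoids computing the division by 2 in [cp]. *)
Definition rtriangle : recf :=
  rPrec rZero (rComp rSucc [rComp rplus [rProj 0; rProj 1]]).

Lemma reval_triangle n : reval rtriangle [n] (n * (n + 1) / 2).
Proof.
  induction n.
  - constructor. apply ev_zero.
  - replace (S n * (S n + 1) / 2) with (S (n + n * (n + 1) / 2)).
    + econstructor; [exact IHn |].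
      eapply reval_comp1; [| apply reval_succ1].
      eapply reval_comp2; [apply ev_proj | apply ev_proj | apply reval_plus].
    + replace (S n * (S n + 1)) with (n * (n + 1) + S n * 2) by lia.
      rewrite Nat.div_add; lia.
Qed.

Definition rcp : recf :=
  rComp rplus [rComp rtriangle [rComp rplus [rProj 0; rProj 1]]; rProj 1].

Lemma reval_cp a b : reval rcp [a; b] (cp a b).
Proof.
  unfold cp.
  eapply reval_comp2; [| apply ev_proj | apply reval_plus].
  eapply reval_comp1; [| apply reval_triangle].
  eapply reval_comp2; [apply ev_proj | apply ev_proj | apply reval_plus].
Qed.

Opaque cp.

(** Serves to give distinct predicates distinct names, so injectivity suffices; no recursive
    function has to compute it. *)
Fixpoint enc_recf (f : recf) : nat :=
  match f with
  | rZero => cp 0 0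
  | rSucc => cp 1 0
  | rProj i => cp 2 i
  | rComp f gs => cp 3 (cp (enc_recf f) (enc_list enc_recf gs))
  | rPrec f g => cp 4 (cp (enc_recf f) (enc_recf g))
  | rMu f => cp 5 (enc_recf f)
  end.

Lemma enc_recf_inj f : forall f', enc_recf f = enc_recf f' -> f = f'.
Proof.
  induction f as [| | i | f gs IHf IHgs | f g IHf IHg | f IHf] using recf_nested_ind;
    intros [| | i' | f' gs' | f' g' | f'] H; simpl in H;
    apply cp_inj in H; destruct H as [Ht H]; try discriminate Ht.
  - reflexivity.
  - reflexivity.
  - now subst.
  - apply cp_inj in H. destruct H as [Hf Hgs].
    f_equal; [now apply IHf |]. clear - IHgs Hgs.
    revert gs' Hgs. induction IHgs as [| g gs Hg _ IH]; intros [| g' gs'] H;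
      simpl in H; try discriminate H; [reflexivity |].
    injection H as H. apply cp_inj in H. destruct H.
    f_equal; auto.
  - apply cp_inj in H. destruct H. f_equal; auto.
  - f_equal; auto.
Qed.

(** * Recursive functions as Horn clauses over the numbers *)

(* [Val f] holds of [y :: v] when [f] maps [v] to [y]; [Pos f] holds of [n :: v] when
   the values of [f] on [m :: v] for [m < n] are all defined and positive. *)
Inductive rname := Val (f : recf) | Pos (f : recf).

(** The two arithmetic forms are what a [pNum] atom can test, with a time point or a shifted time
    variable as its second argument. *)
Inductive natom :=
| IsConst (x c : nat)
| IsPlus (x y c : nat)
| App (R : rname) (xs : list nat).

(* The variables of a clause are [0, ..., nvars - 1]. *)
Record clause := MkClause
  { nvars : nat; cbody : list natom; chead : rname; cargs : list nat }.

Definition nholds (sem : rname -> list nat -> Prop) (a : nat -> nat) (l : natom) : Prop :=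
  match l with
  | IsConst x c => a x = c
  | IsPlus x y c => a x = a y + c
  | App R xs => sem R (map a xs)
  end.

Definition natom_vars (l : natom) : list nat :=
  match l with
  | IsConst x _ => [x]
  | IsPlus x y _ => [x; y]
  | App _ xs => xs
  end.

Definition clause_wf (c : clause) : Prop :=
  Forall (fun x => x < nvars c) (cargs c) /\
  Forall (fun l => Forall (fun x => x < nvars c) (natom_vars l)) (cbody c).

(** Since [recf] carries no arity, the number [k] of arguments is a parameter. Variables below [k]
    are the arguments, [k] is the result (for [Pos], the bound), and later ones are intermediate
    values. Missing arguments count as 0, like the default of [nth]; [rPrec] without arguments has
    no value, hence no clause. The last atom of the third [rMu] clause expresses positivity by
    naming a predecessor. *)
Fixpoint clauses (f : recf) (k : nat) : list clause :=
  let xs := seq 0 k in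
  match f with
  | rZero => [MkClause (S k) [IsConst k 0] (Val f) (k :: xs)]
  | rSucc =>
      [MkClause (S k) [if k =? 0 then IsConst k 1 else IsPlus k 0 1]
         (Val f) (k :: xs)]
  | rProj i =>
      [MkClause (S k) [if i <? k then IsPlus k i 0 else IsConst k 0] (Val f) (k :: xs)]
  | rComp g gs =>
      let ws := seq (S k) (length gs) in
      MkClause (S k + length gs)
        (App (Val g) (k :: ws) ::
         map (fun p => App (Val (fst p)) (snd p :: xs)) (combine gs ws))
        (Val f) (k :: xs)
      :: clauses g (length gs) ++ flat_map (fun g' => clauses g' k) gs
  | rPrec g g' =>
      match k with
      | 0 => []
      | S j =>
          let rest := seq 1 j in
          MkClause (k + 1) [IsConst 0 0; App (Val g) (k :: rest)] (Val f) (k :: xs)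
          :: MkClause (k + 3)
               [IsPlus 0 (k + 1) 1;
                App (Val f) (k + 2 :: k + 1 :: rest);
                App (Val g') (k :: k + 1 :: k + 2 :: rest)] (Val f) (k :: xs)
          :: clauses g j ++ clauses g' (S k)
      end
  | rMu g =>
      MkClause (k + 2)
        [IsConst (k + 1) 0; App (Val g) (k + 1 :: k :: xs); App (Pos g) (k :: xs)]
        (Val f) (k :: xs)
      :: MkClause (k + 1) [IsConst k 0] (Pos g) (k :: xs)
      :: MkClause (k + 4)
           [IsPlus k (k + 1) 1; App (Pos g) (k + 1 :: xs);
            App (Val g) (k + 2 :: k + 1 :: xs); IsPlus (k + 2) (k + 3) 1]
           (Pos g) (k :: xs)
      :: clauses g (S k)
  end.

Lemma Forall_seq_lt s n m : s + n <= m -> Forall (fun x => x < m) (seq s n).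
Proof. intros H. apply Forall_forall. intros x Hx. apply in_seq in Hx. lia. Qed.

Ltac solve_clause_wf :=
  split; simpl; repeat first [lia | apply Forall_seq_lt; lia | constructor].

Lemma clauses_wf f : forall k, Forall clause_wf (clauses f k).
Proof.
  induction f as [| | i | f gs IHf IHgs | f g IHf IHg | f IHf] using recf_nested_ind;
    intros k; simpl.
  - constructor; [solve_clause_wf | constructor].
  - constructor; [| constructor]. destruct (Nat.eqb_spec k 0); solve_clause_wf.
  - constructor; [| constructor]. destruct (Nat.ltb_spec i k); solve_clause_wf.
  - constructor.
    + split; simpl.
      * constructor; [lia | apply Forall_seq_lt; lia].
      * constructor; [simpl; constructor; [lia | apply Forall_seq_lt; lia] |].
        apply Forall_map, Forall_forall. intros [g w] Hp.
        apply in_combine_r, in_seq in Hp. simpl.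
        constructor; [lia | apply Forall_seq_lt; lia].
    + apply Forall_app. split; [apply IHf |].
      apply Forall_flat_map. eapply Forall_impl; [| exact IHgs]. auto.
  - destruct k as [| j]; [constructor |].
    constructor; [solve_clause_wf | constructor; [solve_clause_wf |]].
    apply Forall_app; auto.
  - constructor; [solve_clause_wf |].
    constructor; [solve_clause_wf | constructor; [solve_clause_wf | auto]].
Qed.

Definition intended (R : rname) (args : list nat) : Prop :=
  match R, args with
  | Val f, y :: v => reval f v y
  | Pos f, n :: v => forall m, m < n -> exists k, reval f (m :: v) (S k)
  | _, [] => False
  end.

Definition sound_clause (c : clause) : Prop :=
  forall a, Forall (nholds intended a) (cbody c) -> intended (chead c) (map a (cargs c)).

Lemma nth_map_seq (a : nat -> nat) i k : i < k -> nth i (map a (seq 0 k)) 0 = a i.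
Proof.
  intros H. rewrite nth_indep with (d' := a 0) by now rewrite length_map, length_seq.
  rewrite map_nth, seq_nth; auto.
Qed.

Lemma clauses_sound f : forall k, Forall sound_clause (clauses f k).
Proof.
  induction f as [| | i | f gs IHf IHgs | f g IHf IHg | f IHf] using recf_nested_ind;
    intros k; simpl.
  - repeat constructor. intros a H. inversion H; subst; simpl in *.
    replace (a k) with 0 by auto. constructor.
  - repeat constructor. intros a H. inversion H as [| ? ? Hk]; subst; simpl in *.
    replace (a k) with (S (nth 0 (map a (seq 0 k)) 0)); [constructor |].
    destruct (Nat.eqb_spec k 0) as [-> |]; simpl in *; [lia |].
    rewrite nth_map_seq; lia.
  - repeat constructor. intros a H. inversion H as [| ? ? Hk]; subst; simpl in *.
    replace (a k) with (nth i (map a (seq 0 k)) 0); [constructor |].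
    destruct (Nat.ltb_spec i k); simpl in Hk.
    + rewrite nth_map_seq; lia.
    + rewrite nth_overflow; [lia |]. now rewrite length_map, length_seq.
  - constructor; [| apply Forall_app; split; [apply IHf |]].
    + intros a H. simpl in H. inversion_clear H as [| ? ? Hf Hgs]. simpl in *.
      apply ev_comp with (map a (seq (S k) (length gs))); [| exact Hf].
      (* The first intermediate variable shifts with each member of [gs], so it is generalised
         before the induction. *)
      clear - Hgs. revert Hgs. generalize (S k) as s.
      induction gs as [| g gs IH]; intros s H; simpl in *; [constructor |].
      inversion_clear H. constructor; auto.
    + apply Forall_flat_map. eapply Forall_impl; [| exact IHgs]. auto.
  - destruct k as [| j]; [constructor |].
    constructor; [| constructor; [| apply Forall_app; auto]];
      intros a H; simpl in *.
    + inversion_clear H as [| ? ? H0 H']. inversion_clear H' as [| ? ? Hf _]. simpl in *.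
      rewrite H0. now constructor.
    + inversion_clear H as [| ? ? H0 H']. inversion_clear H' as [| ? ? Hf H].
      inversion_clear H as [| ? ? Hg _]. simpl in *.
      rewrite H0, Nat.add_1_r. econstructor; eassumption.
  - constructor; [| constructor; [| constructor; [| auto]]]; intros a H; simpl in *.
    + inversion_clear H as [| ? ? H0 H']. inversion_clear H' as [| ? ? Hf H].
      inversion_clear H as [| ? ? Hp _]. simpl in *.
      rewrite H0 in Hf. now constructor.
    + inversion_clear H as [| ? ? H0 _]. simpl in *. lia.
    + inversion_clear H as [| ? ? H0 H']. inversion_clear H' as [| ? ? Hp H].
      inversion_clear H as [| ? ? Hf H']. inversion_clear H' as [| ? ? Hs _]. simpl in *.
      (* The clause extends the range by one: the new number [a (k + 1)] is tested directly, smaller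
         ones are covered by the premise on [Pos]. *)
      intros m Hm. destruct (Nat.eq_dec m (a (k + 1))) as [-> | Hne].
      * exists (a (k + 3)). rewrite Hs, !Nat.add_1_r in Hf. now rewrite Nat.add_1_r.
      * apply Hp. lia.
Qed.

(** * Derivations that use only an initial segment of the numbers *)

Definition eventually (P : nat -> Prop) : Prop :=
  exists B0, forall B, B0 <= B -> P B.

Lemma eventually_mono (P Q : nat -> Prop) :
  (forall B, P B -> Q B) -> eventually P -> eventually Q.
Proof. intros H [B0 HP]. exists B0. auto. Qed.

Lemma eventually_and (P Q : nat -> Prop) :
  eventually P -> eventually Q -> eventually (fun B => P B /\ Q B).
Proof.
  intros [B0 HP] [B1 HQ]. exists (max B0 B1). intros B HB.
  split; [apply HP | apply HQ]; lia.
Qed.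

Lemma eventually_ge n : eventually (fun B => n <= B).
Proof. exists n. auto. Qed.

Lemma eventually_Forall2 {A C} (P : A -> C -> nat -> Prop) l l' :
  Forall2 (fun x y => eventually (P x y)) l l' ->
  eventually (fun B => Forall2 (fun x y => P x y B) l l').
Proof.
  induction 1 as [| x y l l' Hx _ IH].
  - exists 0. constructor.
  - apply (eventually_mono (fun B => P x y B /\ Forall2 (fun x y => P x y B) l l')).
    + intros B []. now constructor.
    + now apply eventually_and.
Qed.

Lemma eventually_forall_lt (P : nat -> nat -> Prop) n :
  (forall m, m < n -> eventually (P m)) -> eventually (fun B => forall m, m < n -> P m B).
Proof.
  induction n as [| n IH]; intros H.
  - exists 0. lia.
  - apply (eventually_mono (fun B => P n B /\ forall m, m < n -> P m B)).
    + intros B [Hn Hlt] m Hm. destruct (Nat.eq_dec m n) as [-> |]; [exact Hn |].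
      apply Hlt. lia.
    + apply eventually_and; auto.
Qed.

(** Finite data supply numerals only up to some [B], so clauses are instantiated only with numbers
    up to that bound. *)
Definition closed_upto (B : nat) (sem : rname -> list nat -> Prop) (cs : list clause) : Prop :=
  Forall (fun c => forall a, (forall i, i < nvars c -> a i <= B) ->
            Forall (nholds sem a) (cbody c) -> sem (chead c) (map a (cargs c))) cs.

(** Derivability is membership in every closed [sem], so that an arbitrary model of the rules can be
    plugged in. The numbers themselves are bounded too, since later clause instances mention
    them. *)
Definition derived_upto (f : recf) (v : list nat) (y B : nat) : Prop :=
  Forall (fun x => x <= B) (y :: v) /\
  forall sem, closed_upto B sem (clauses f (length v)) -> sem (Val f) (y :: v).

(** The default 0 is below every bound, so bounding the listed values bounds the valuation. *)
Definition valuation (l : list nat) (i : nat) : nat := nth i l 0.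

Lemma valuation_le B l : Forall (fun x => x <= B) l -> forall i, valuation l i <= B.
Proof.
  unfold valuation. intros H i. destruct (Nat.lt_ge_cases i (length l)) as [L | L].
  - rewrite Forall_forall in H. apply H, nth_In, L.
  - rewrite nth_overflow; lia.
Qed.

Lemma valuation_block l1 l2 l3 :
  map (valuation (l1 ++ l2 ++ l3)) (seq (length l1) (length l2)) = l2.
Proof.
  revert l1. induction l2 as [| x l2 IH]; intros l1; simpl; [reflexivity |].
  f_equal.
  - apply nth_middle.
  - specialize (IH (l1 ++ [x])). rewrite <- app_assoc, length_app, Nat.add_1_r in IH.
    exact IH.
Qed.

Lemma valuation_prefix l1 l2 : map (valuation (l1 ++ l2)) (seq 0 (length l1)) = l1.
Proof. exact (valuation_block [] l1 l2). Qed.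

Lemma valuation_mid l1 x l2 : valuation (l1 ++ x :: l2) (length l1) = x.
Proof. apply nth_middle. Qed.

Lemma valuation_plus l1 l2 n : valuation (l1 ++ l2) (length l1 + n) = nth n l2 0.
Proof. apply app_nth2_plus. Qed.

Lemma closed_head B sem nv b R xs cs l :
  closed_upto B sem (MkClause nv b R xs :: cs) ->
  Forall (fun x => x <= B) l -> Forall (nholds sem (valuation l)) b ->
  sem R (map (valuation l) xs).
Proof.
  intros Hc Hl Hb. inversion_clear Hc as [| ? ? H _]. apply H; [| exact Hb].
  intros i _. now apply valuation_le.
Qed.

Lemma closed_tail B sem c cs : closed_upto B sem (c :: cs) -> closed_upto B sem cs.
Proof. intros H. now inversion H. Qed.

(** Covers the three basic functions; the largest number mentioned is a sufficient bound. *)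
Lemma leaf_derived f v y l :
  clauses f (length v) =
    [MkClause (S (length v)) [l] (Val f) (length v :: seq 0 (length v))] ->
  (forall sem, nholds sem (valuation (v ++ [y])) l) ->
  eventually (derived_upto f v y).
Proof.
  intros Hcl Hl. exists (list_max (y :: v)). intros B HB.
  apply list_max_le in HB. split; [exact HB |].
  intros sem Hsem. rewrite Hcl in Hsem. apply closed_head with (l := v ++ [y]) in Hsem.
  - simpl in Hsem. now rewrite valuation_mid, valuation_prefix in Hsem.
  - inversion HB. apply Forall_app. auto.
  - auto.
Qed.

(** By induction on the evaluation: each step adds finitely many clause instances, and the finitely
    many bounds of its premises have a maximum. *)
Lemma reval_derived f v y : reval f v y -> eventually (derived_upto f v y).
Proof.
  revert f v y. apply reval_nested_ind.
  - intros v. eapply leaf_derived; [reflexivity |]. intros sem. apply valuation_mid.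
  - intros v. eapply leaf_derived; [reflexivity |]. intros sem.
    destruct v as [| x v]; [reflexivity |].
    change (valuation ((x :: v) ++ [S x]) (length (x :: v)) = x + 1).
    rewrite valuation_mid. lia.
  - intros i v. eapply leaf_derived; [reflexivity |]. intros sem.
    destruct (Nat.ltb_spec i (length v)); simpl; rewrite valuation_mid.
    + unfold valuation. rewrite app_nth1; lia.
    + now rewrite nth_overflow.
  - intros f gs v ws y Hgs Hf. apply eventually_Forall2 in Hgs.
    (* If [gs] is empty, no premise bounds [v]; hence the explicit bound. *)
    eapply eventually_mono; [| apply eventually_and;
      [exact Hgs | apply eventually_and; [exact Hf | apply (eventually_ge (list_max v))]]].
    clear Hgs Hf. intros B [Hgs [[Hy Hf] Hv]]. apply list_max_le in Hv.
    inversion_clear Hy as [| ? ? Hy' Hws].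
    split; [auto |]. intros sem Hsem. simpl in Hsem.
    pose proof (Forall2_length Hgs) as Hlen. rewrite Hlen in Hsem.
    apply closed_tail in Hsem as Hsub. apply Forall_app in Hsub. destruct Hsub as [Hsubf Hsubg].
    apply closed_head with (l := v ++ y :: ws) in Hsem.
    + simpl in Hsem. now rewrite valuation_mid, valuation_prefix in Hsem.
    + apply Forall_app. auto.
    + assert (Hblock : map (valuation (v ++ y :: ws)) (seq (S (length v)) (length ws)) = ws).
      { pose proof (valuation_block (v ++ [y]) ws []) as E.
        rewrite length_app, Nat.add_1_r, app_nil_r, <- app_assoc in E. exact E. }
      constructor.
      * simpl. rewrite valuation_mid.
        rewrite Hblock. apply Hf, Hsubf.
      * apply Forall_map.
        revert Hblock. generalize (seq (S (length v)) (length ws)) as is.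
        generalize (valuation_prefix v (y :: ws)).
        generalize (valuation (v ++ y :: ws)) as a. intros a Ha is His.
        clear - Hgs Ha His Hsubg. subst ws.
        revert is Hgs. induction gs as [| g gs IH]; intros is Hgs; [constructor |].
        destruct is as [| i is]; [constructor |]. simpl in *.
        inversion_clear Hgs as [| ? ? ? ? Hg Hgs'].
        apply Forall_app in Hsubg. destruct Hsubg.
        constructor; [simpl; rewrite Ha; now apply Hg | now apply IH].
  - intros f g rest y Hf.
    eapply eventually_mono; [| exact Hf].
    clear Hf. intros B [Hy Hf]. inversion_clear Hy as [| ? ? Hy' Hr].
    split; [repeat constructor; auto; lia |]. intros sem Hsem. simpl in Hsem.
    apply closed_tail in Hsem as Hsub. apply closed_tail in Hsub.
    apply Forall_app in Hsub. destruct Hsub as [Hsub _].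
    assert (Hk : valuation (0 :: rest ++ [y]) (S (length rest)) = y)
      by apply (valuation_mid (0 :: rest)).
    pose proof (valuation_block [0] rest [y]) as Hrest.
    change (map (valuation (0 :: rest ++ [y])) (seq 1 (length rest)) = rest) in Hrest.
    apply closed_head with (l := 0 :: rest ++ [y]) in Hsem.
    + cbn [map] in Hsem. rewrite Hk, Hrest in Hsem. exact Hsem.
    + constructor; [lia |]. apply Forall_app. auto.
    + repeat constructor; cbn [nholds map]. rewrite Hk, Hrest. apply Hf, Hsub.
  - intros f g n rest z y Hf Hg.
    (* The premises bound [n] but not the new argument [S n]. *)
    eapply eventually_mono; [| apply eventually_and;
      [exact Hf | apply eventually_and; [exact Hg | apply (eventually_ge (S n))]]].
    clear Hf Hg. intros B [[Hz Hf] [[Hy Hg] Hn]].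
    inversion_clear Hz as [| ? ? Hz' Hv]. inversion_clear Hv as [| ? ? _ Hr].
    inversion_clear Hy as [| ? ? Hy' _].
    split; [repeat constructor; auto |]. intros sem Hsem.
    specialize (Hf sem Hsem). simpl in Hsem.
    apply closed_tail in Hsem. apply closed_tail in Hsem as Hsub.
    apply Forall_app in Hsub. destruct Hsub as [_ Hsub].
    (* After the arguments come the result, the predecessor and the previous value, in the order of
       the variables [k], [k + 1], [k + 2]. *)
    specialize (Hg sem Hsub). set (l := (S n :: rest) ++ [y; n; z]).
    assert (Hk : valuation l (S (length rest)) = y) by apply (valuation_mid (S n :: rest)).
    assert (Hk1 : valuation l (S (length rest + 1)) = n)
      by apply (valuation_plus (S n :: rest)).
    assert (Hk2 : valuation l (S (length rest + 2)) = z)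
      by apply (valuation_plus (S n :: rest)).
    pose proof (valuation_block [S n] rest [y; n; z]) as Hrest.
    change (map (valuation l) (seq 1 (length rest)) = rest) in Hrest.
    apply closed_head with (l := l) in Hsem.
    + cbn [map] in Hsem. rewrite Hk, Hrest in Hsem. exact Hsem.
    + apply Forall_app. split; repeat constructor; auto. lia.
    + repeat constructor; cbn [nholds map]; rewrite ?Hk, ?Hk1, ?Hk2, ?Hrest; auto.
      change (valuation l 0) with (S n). lia.
  - intros f v n Hf Hpos.
    assert (Hpos' : eventually (fun B => forall m, m < n -> exists k, derived_upto f (m :: v) (S k) B)).
    { apply eventually_forall_lt. intros m Hm. destruct (Hpos m Hm) as [k Hk].
      eapply eventually_mono; [| exact Hk]. eauto. }
    eapply eventually_mono; [| apply eventually_and; [exact Hf | exact Hpos']].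
    clear Hf Hpos Hpos'. intros B [[Hn Hf] Hpos].
    inversion_clear Hn as [| ? ? _ Hn']. inversion_clear Hn' as [| ? ? Hn Hv].
    split; [auto |]. intros sem Hsem. simpl in Hsem.
    apply closed_tail in Hsem as Hsem1. apply closed_tail in Hsem1 as Hsem2.
    apply closed_tail in Hsem2 as Hsub. specialize (Hf sem Hsub).
    (* [Pos f] is derived at 0, 1, ..., [n] in turn, each step using the positive value at the
       preceding number. *)
    assert (HP : forall m, m <= n -> sem (Pos f) (m :: v)).
    { induction m as [| m IHm]; intros Hm.
      - apply closed_head with (l := v ++ [0]) in Hsem1.
        + cbn [map] in Hsem1. now rewrite valuation_mid, valuation_prefix in Hsem1.
        + apply Forall_app. split; [auto | repeat constructor; lia].
        + repeat constructor. apply valuation_mid.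
      - destruct (Hpos m Hm) as [k [Hk Hfk]]. specialize (Hfk sem Hsub).
        inversion_clear Hk as [| ? ? Hk' _].
        (* The final [k] is the predecessor witnessing that the value [S k] is positive. *)
        apply closed_head with (l := v ++ [S m; m; S k; k]) in Hsem2.
        + cbn [map] in Hsem2. now rewrite valuation_mid, valuation_prefix in Hsem2.
        + apply Forall_app. split; [auto | repeat constructor; lia].
        + repeat constructor; cbn [nholds map];
            rewrite ?valuation_prefix, ?valuation_plus, ?valuation_mid; simpl; auto.
          * lia.
          * apply IHm. lia.
          * lia. }
    apply closed_head with (l := v ++ [n; 0]) in Hsem.
    + cbn [map] in Hsem. now rewrite valuation_mid, valuation_prefix in Hsem.
    + apply Forall_app. split; [auto | repeat constructor; lia].
    + repeat constructor; cbn [nholds map];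
        rewrite ?valuation_prefix, ?valuation_plus, ?valuation_mid; simpl; auto.
Qed.

(** * The temporal program of a recursive function *)

Definition enc_rname (R : rname) : nat :=
  match R with
  | Val f => cp 0 (enc_recf f)
  | Pos f => cp 1 (enc_recf f)
  end.

Lemma enc_rname_inj R R' : enc_rname R = enc_rname R' -> R = R'.
Proof.
  destruct R, R'; simpl; intros H; apply cp_inj in H; destruct H as [Ht H];
    try discriminate Ht; f_equal; now apply enc_recf_inj.
Qed.

Definition pZero : pred := MkPred 0 false [SObj].
Definition pSucc : pred := MkPred 1 false [SObj; SObj].
Definition pTick : pred := MkPred 2 false [STime].
(* [pNum x t]: the object [x] is a numeral for [t]. *)
Definition pNum : pred := MkPred 0 true [SObj; STime].
(* [pAbove x t]: the object [x] is a numeral for some [s < t]. *)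
Definition pAbove : pred := MkPred 1 true [SObj; STime].
(** The input is given as a time point, because which object denotes a number depends on the
    data. *)
Definition pInput : pred := MkPred 2 true [STime].
Definition pGoal : pred := MkPred 3 true [STime].
(** The offset avoids the four intensional predicates above. Different arities give different
    predicates, so one function can occur at several arities. *)
Definition pRel (R : rname) (n : nat) : pred :=
  MkPred (4 + enc_rname R) true (repeat SObj n).

Definition zero_fact (x : nat) : atom := MkAtom pZero [TObj x].
Definition succ_fact (x y : nat) : atom := MkAtom pSucc [TObj x; TObj y].
Definition tick_fact (t : Z) : atom := MkAtom pTick [TTime t].

Definition guard (m : nat) : list atom :=
  map (fun i => MkAtom pNum [TOVar i; TTVar i]) (seq 0 m).

Definition rel_atom (R : rname) (xs : list nat) : atom :=
  MkAtom (pRel R (length xs)) (map TOVar xs).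

Definition natom_atom (l : natom) : atom :=
  match l with
  | IsConst x c => MkAtom pNum [TOVar x; TTime (Z.of_nat c)]
  | IsPlus x y c => MkAtom pNum [TOVar x; TTPlus y (Z.of_nat c)]
  | App R xs => rel_atom R xs
  end.

(* The guard makes the time variable [i] hold the number denoted by the object
   variable [i]. *)
Definition clause_rule (c : clause) : rule :=
  MkRule (guard (nvars c) ++ map natom_atom (cbody c)) (rel_atom (chead c) (cargs c)).

Definition num_rules : list rule :=
  [MkRule [MkAtom pZero [TOVar 0]] (MkAtom pNum [TOVar 0; TTime 0]);
   MkRule [MkAtom pSucc [TOVar 0; TOVar 1]; MkAtom pNum [TOVar 0; TTVar 0]]
     (MkAtom pNum [TOVar 1; TTPlus 0 1]);
   MkRule [MkAtom pNum [TOVar 0; TTVar 0]] (MkAtom pAbove [TOVar 0; TTPlus 0 1]);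
   MkRule [MkAtom pAbove [TOVar 0; TTVar 0]] (MkAtom pAbove [TOVar 0; TTPlus 0 1])].

Definition ambiguity_rule : rule :=
  MkRule [MkAtom pTick [TTVar 1]; MkAtom pNum [TOVar 0; TTVar 0];
          MkAtom pAbove [TOVar 0; TTVar 0]]
    (MkAtom pGoal [TTVar 1]).

(** Object and time variables are numbered independently: objects 0 and 1 are the result and the
    input, times 0 and 1 the input's number and the time of the goal. *)
Definition goal_rule (h : recf) : rule :=
  MkRule [MkAtom pTick [TTVar 1]; MkAtom pTick [TTPlus 1 1];
          MkAtom pInput [TTVar 0]; MkAtom pNum [TOVar 1; TTVar 0];
          MkAtom pNum [TOVar 0; TTime 0]; rel_atom (Val h) [0; 1]]
    (MkAtom pGoal [TTVar 1]).

(** The input rule is kept out, so that the code of this list can itself be the input. *)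
Definition base_program (h : recf) : program :=
  goal_rule h :: ambiguity_rule :: num_rules ++ map clause_rule (clauses h 1).

Definition input_rule (n : nat) : rule := MkRule [] (MkAtom pInput [TTime (Z.of_nat n)]).

Definition machine_query (h : recf) (n : nat) : query :=
  MkQuery pGoal (input_rule n :: base_program h).

(** * Well-formedness of the program *)

Lemma rt_rigid p xs : psorts p = repeat SObj (length xs) -> rt_atom (MkAtom p (map TOVar xs)).
Proof.
  intros Hp. split.
  - unfold well_sorted. simpl. rewrite Hp, map_map. clear.
    induction xs; simpl; [reflexivity | now f_equal].
  - left. unfold rigid. simpl. rewrite Hp.
    apply Forall_forall. intros s. apply repeat_spec.
Qed.

Lemma rt_num x t : term_sort t = STime -> rt_atom (MkAtom pNum [TOVar x; t]).
Proof.
  intros Ht. split.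
  - unfold well_sorted. simpl. now rewrite Ht.
  - right. exists [SObj]. auto.
Qed.

Lemma temporal_time i b : temporal (MkPred i b [STime]).
Proof. exists []. auto. Qed.

(** The guards mention every variable of the clause, which makes the rule safe. *)
Lemma clause_rule_wf c : clause_wf c -> wf_rule (clause_rule c).
Proof.
  intros [Hhead Hbody]. split; [| split; [| split]].
  - now apply rt_rigid.
  - apply Forall_app. split; apply Forall_map, Forall_forall.
    + intros i _. now apply rt_num.
    + intros [] _; [now apply rt_num | now apply rt_num | now apply rt_rigid].
  - reflexivity.
  - intros v Hv. apply in_flat_map in Hv. destruct Hv as [t [Ht Hv]].
    apply in_map_iff in Ht. destruct Ht as [x [<- Hx]]. destruct Hv as [<- | []].
    exists (MkAtom pNum [TOVar x; TTVar x]). split.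
    + apply in_app_iff. left. apply (in_map (fun i => MkAtom pNum [TOVar i; TTVar i])).
      apply in_seq. rewrite Forall_forall in Hhead. apply Hhead in Hx. lia.
    + simpl. auto.
Qed.

Ltac solve_rt_atom :=
  split; [reflexivity |
    first [left; repeat constructor; fail
          | right; exists []; split; [reflexivity | repeat constructor]
          | right; exists [SObj]; split; [reflexivity | repeat constructor]]].

Ltac pick_disjunct := (left; reflexivity) + (right; pick_disjunct).

Ltac solve_wf_rule :=
  split; [solve_rt_atom |
    split; [repeat (apply Forall_cons; [solve_rt_atom |]); apply Forall_nil |
      split; [first [reflexivity | now intros []] |
        simpl; intros v Hv; repeat destruct Hv as [<- | Hv]; try destruct Hv;
        (eexists; split; [pick_disjunct | simpl; solve [auto]])]]].

Lemma machine_query_temporal h n : temporal_query (machine_query h n).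
Proof.
  split; [| split; [reflexivity | split]].
  - constructor; [solve_wf_rule |].
    constructor; [solve_wf_rule |].
    constructor; [solve_wf_rule |].
    apply Forall_app. split.
    + repeat (apply Forall_cons; [solve_wf_rule |]). apply Forall_nil.
    + apply Forall_map. eapply Forall_impl; [apply clause_rule_wf | apply clauses_wf].
  - exists (goal_rule h). simpl. auto.
  - apply temporal_time.
Qed.

(** * Soundness of the program *)

Inductive numeral (E : dataset) : nat -> nat -> Prop :=
| numeral_zero x : In (zero_fact x) E -> numeral E x 0
| numeral_succ x y t : In (succ_fact x y) E -> numeral E x t -> numeral E y (S t).

Definition ambiguous (E : dataset) : Prop :=
  exists x s t, s < t /\ numeral E x s /\ numeral E x t.

Lemma numeral_unique E x s t :
  ~ ambiguous E -> numeral E x s -> numeral E x t -> s = t.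
Proof.
  intros HE Hs Ht. destruct (Nat.lt_trichotomy s t) as [L | [-> | L]]; [| reflexivity |];
    exfalso; apply HE; [exists x, s, t | exists x, t, s]; auto.
Qed.

Definition reify (d : nat + Z) : term :=
  match d with inl c => TObj c | inr z => TTime z end.

Definition denotes (E : dataset) (d : nat + Z) (t : nat) : Prop :=
  exists x, d = inl x /\ numeral E x t.

(* On an ambiguous dataset the clause predicates hold of everything. *)
Definition model (E : dataset) (h : recf) (n : nat) (p : pred) (args : list (nat + Z)) : Prop :=
  if pidb p then
    match pid p, args with
    | 0, [inl x; inr z] => exists t, z = Z.of_nat t /\ numeral E x t
    | 1, [inl x; inr z] => exists s t, z = Z.of_nat t /\ s < t /\ numeral E x s
    | 2, [inr z] => z = Z.of_nat n
    | 3, [inr z] => In (tick_fact z) E /\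
        (~ ambiguous E -> In (tick_fact (z + 1)) E /\ reval h [n] 0)
    | S (S (S (S c))), _ => exists R, c = enc_rname R /\
        (~ ambiguous E -> exists ts, Forall2 (denotes E) args ts /\ intended R ts)
    | _, _ => False
    end
  else In (MkAtom p (map reify args)) E.

Definition model_sat (E : dataset) (h : recf) (n : nat) : rule -> Prop :=
  sat_rule nat (fun c => c) (model E h n).

Lemma model_fact E h n a : is_dataset E -> In a E -> model_sat E h n (fact_rule a).
Proof.
  intros HE Ha ov tv _. unfold is_dataset in HE. rewrite Forall_forall in HE.
  destruct (HE a Ha) as [[_ Hg] Hp]. unfold holds, model. simpl. rewrite Hp, map_map.
  replace (map _ (aargs a)) with (aargs a); [now destruct a |].
  symmetry. rewrite <- map_id. apply map_ext_Forall.
  eapply Forall_impl; [| exact Hg]. intros []; simpl; intros []; reflexivity.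
Qed.

(** Identifies the numbers hidden in the existential of [model] with those that the guards assign to
    the variables. *)
Lemma denotes_unique E (ov : nat -> nat) a m xs ts :
  ~ ambiguous E -> (forall i, i < m -> numeral E (ov i) (a i)) ->
  Forall (fun x => x < m) xs ->
  Forall2 (denotes E) (map (fun x => inl (ov x)) xs) ts -> ts = map a xs.
Proof.
  intros HE Ha Hxs. revert ts. induction Hxs as [| x xs Hx _ IH]; intros ts H;
    inversion H as [| ? t ? ? [y [Hy Ht]]]; subst; [reflexivity |].
  injection Hy as <-. simpl. f_equal; [| auto].
  now apply (numeral_unique E (ov x)); [| | apply Ha].
Qed.

(** Ambiguous data make the head true by definition of [model]. Otherwise numerals are unique, the
    arithmetic atoms become equations between numbers, and soundness over the numbers applies. *)
Lemma model_clause E h n c :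
  clause_wf c -> sound_clause c -> model_sat E h n (clause_rule c).
Proof.
  intros [Hhead Hbody] Hc ov tv Hb. exists (chead c). split; [reflexivity |]. intros HE.
  (* On the variables of the clause [Z.to_nat] loses nothing: each guard forces [tv i] to be
     nonnegative. *)
  set (a := fun i => Z.to_nat (tv i)).
  assert (Ha : forall i, i < nvars c -> tv i = Z.of_nat (a i) /\ numeral E (ov i) (a i)).
  { intros i Hi.
    assert (Hg : In (MkAtom pNum [TOVar i; TTVar i]) (body (clause_rule c))).
    { apply in_app_iff. left. apply (in_map (fun i => MkAtom pNum [TOVar i; TTVar i])).
      apply in_seq. lia. }
    apply Hb in Hg. destruct Hg as [t [Ht Hnum]]. unfold a. rewrite Ht, Nat2Z.id. auto. }
  exists (map a (cargs c)). split.
  - simpl. rewrite map_map. clear - Ha Hhead.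
    induction Hhead as [| x xs Hx _ IH]; constructor; [| exact IH].
    exists (ov x). split; [reflexivity | now apply Ha].
  - apply Hc. apply Forall_forall. intros l Hl.
    rewrite Forall_forall in Hbody. specialize (Hbody l Hl).
    assert (Hat : holds nat (fun c => c) (model E h n) ov tv (natom_atom l)).
    { apply Hb. apply in_app_iff. right. now apply in_map. }
    destruct l as [x k | x y k | R xs]; simpl in Hbody.
    + inversion_clear Hbody as [| ? ? Hx _]. destruct Hat as [t [Ht Hnum]].
      apply Nat2Z.inj in Ht. subst t.
      apply (numeral_unique E (ov x)); [exact HE | now apply Ha | exact Hnum].
    + inversion_clear Hbody as [| ? ? Hx Hy']. inversion_clear Hy' as [| ? ? Hy _].
      destruct Hat as [t [Ht Hnum]]. apply Ha in Hy. destruct Hy as [Hy _].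
      rewrite Hy, <- Nat2Z.inj_add in Ht. apply Nat2Z.inj in Ht. subst t.
      apply (numeral_unique E (ov x)); [exact HE | now apply Ha | exact Hnum].
    + destruct Hat as [R' [HR Hat]]. apply enc_rname_inj in HR. subst R'.
      destruct (Hat HE) as [ts [Hts Hint]]. simpl in Hts. rewrite map_map in Hts.
      apply denotes_unique with (a := a) (m := nvars c) in Hts; auto.
      * subst ts. exact Hint.
      * intros i Hi. now apply Ha.
Qed.

Lemma model_program E h n r :
  is_dataset E -> In r (qprog (machine_query h n) ++ map fact_rule E) -> model_sat E h n r.
Proof.
  intros HE Hr. apply in_app_iff in Hr. destruct Hr as [Hr | Hr].
  2: { apply in_map_iff in Hr. destruct Hr as [a [<- Ha]]. now apply model_fact. }
  destruct Hr as [<- | [<- | [<- | Hr]]]; [| | | apply in_app_iff in Hr; destruct Hr as [Hr | Hr]].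
  - intros ov tv _. reflexivity.
  - intros ov tv Hb. split.
    + exact (Hb _ (or_introl eq_refl)).
    + intros Hamb. split.
      * exact (Hb _ (or_intror (or_introl eq_refl))).
      * assert (Hin : tv 0 = Z.of_nat n) by (apply (Hb (MkAtom pInput [TTVar 0])); simpl; auto).
        destruct (Hb (MkAtom pNum [TOVar 1; TTVar 0])) as [t [Ht Hnum]]; [simpl; auto |].
        destruct (Hb (MkAtom pNum [TOVar 0; TTime 0])) as [t0 [Ht0 Hnum0]]; [simpl; auto 6 |].
        destruct (Hb (rel_atom (Val h) [0; 1])) as [R [HR Hrel]]; [simpl; auto 7 |].
        apply enc_rname_inj in HR. subst R. destruct (Hrel Hamb) as [ts [Hts Hint]].
        apply (denotes_unique E ov (fun i => match i with 0 => 0 | _ => n end) 2 [0; 1]) in Hts;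
          [subst ts; exact Hint | exact Hamb | | repeat constructor].
        rewrite Hin in Ht. apply Nat2Z.inj in Ht. subst t.
        change 0%Z with (Z.of_nat 0) in Ht0. apply Nat2Z.inj in Ht0. subst t0.
        intros [| [| i]] Hi; [exact Hnum0 | exact Hnum | lia].
  - intros ov tv Hb. split.
    + exact (Hb _ (or_introl eq_refl)).
    + intros Hamb. exfalso. apply Hamb.
      destruct (Hb (MkAtom pNum [TOVar 0; TTVar 0])) as [t [Ht Hnum]]; [simpl; auto |].
      destruct (Hb (MkAtom pAbove [TOVar 0; TTVar 0])) as [s [t' [Ht' [Hlt Habove]]]];
        [simpl; auto |].
      rewrite Ht in Ht'. apply Nat2Z.inj in Ht'. subst t'. exists (ov 0), s, t. auto.
  - destruct Hr as [<- | [<- | [<- | [<- | []]]]]; intros ov tv Hb.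
    + exists 0. split; [reflexivity |]. apply numeral_zero.
      exact (Hb _ (or_introl eq_refl)).
    + destruct (Hb (MkAtom pNum [TOVar 0; TTVar 0])) as [t [Ht Hnum]]; [simpl; auto |].
      exists (S t). split; [lia |]. apply numeral_succ with (ov 0); [| exact Hnum].
      exact (Hb _ (or_introl eq_refl)).
    + destruct (Hb _ (or_introl eq_refl)) as [t [Ht Hnum]].
      exists t, (S t). split; [lia |]. auto.
    + destruct (Hb _ (or_introl eq_refl)) as [s [t [Ht [Hlt Hnum]]]].
      exists s, (S t). split; [lia |]. auto.
  - apply in_map_iff in Hr. destruct Hr as [c [<- Hc]].
    pose proof (clauses_wf h 1) as Hwf. pose proof (clauses_sound h 1) as Hsound.
    rewrite Forall_forall in Hwf, Hsound. apply model_clause; auto.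
Qed.

Definition goal_atom (t : Z) : atom := MkAtom pGoal [TTime t].

Lemma goal_sound E h n tau :
  is_dataset E ->
  entails (qprog (machine_query h n) ++ map fact_rule E) (goal_atom tau) ->
  In (tick_fact tau) E /\
  (~ ambiguous E -> In (tick_fact (tau + 1)) E /\ reval h [n] 0).
Proof.
  intros HE H. apply (H nat (fun c => c) (model E h n)).
  - intros r Hr. now apply model_program.
  - exact (fun _ => 0).
  - exact (fun _ => 0%Z).
Qed.

(** * Completeness of the program *)

Lemma sat_num_rules Dom objc rel E :
  (forall r, In r (num_rules ++ map fact_rule E) -> sat_rule Dom objc rel r) ->
  forall x t, numeral E x t -> rel pNum [inl (objc x); inr (Z.of_nat t)].
Proof.
  intros H x t Hnum. induction Hnum as [x Hx | x y t Hxy _ IH].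
  (* The index selects the first rule of the list; the default of [nth] is never reached. *)
  - apply (H (nth 0 num_rules (input_rule 0)) ltac:(simpl; auto)
      (fun _ => objc x) (fun _ => 0%Z)).
    intros b [<- | []].
    apply (H (fact_rule (zero_fact x))
      ltac:(apply in_app_iff; right; now apply in_map) (fun _ => objc x) (fun _ => 0%Z)).
    intros b [].
  - rewrite Nat2Z.inj_succ.
    apply (H (nth 1 num_rules (input_rule 0)) ltac:(simpl; auto)
      (fun i => match i with 0 => objc x | _ => objc y end) (fun _ => Z.of_nat t)).
    intros b [<- | [<- | []]]; [| exact IH].
    apply (H (fact_rule (succ_fact x y))
      ltac:(apply in_app_iff; right; now apply in_map) (fun _ => objc x) (fun _ => 0%Z)).
    intros b [].
Qed.

Lemma sat_above Dom objc rel E :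
  (forall r, In r (num_rules ++ map fact_rule E) -> sat_rule Dom objc rel r) ->
  forall x s t, numeral E x s -> s < t -> rel pAbove [inl (objc x); inr (Z.of_nat t)].
Proof.
  intros H x s t Hs Hlt. induction Hlt as [| t _ IH]; rewrite Nat2Z.inj_succ.
  - apply (H (nth 2 num_rules (input_rule 0)) ltac:(simpl; auto)
      (fun _ => objc x) (fun _ => Z.of_nat s)).
    intros b [<- | []]. now apply (sat_num_rules Dom objc rel E H).
  - apply (H (nth 3 num_rules (input_rule 0)) ltac:(simpl; auto)
      (fun _ => objc x) (fun _ => Z.of_nat t)).
    now intros b [<- | []].
Qed.

(** One tick is enough and [h] is arbitrary; in [delay_holds] this yields the goal from the history
    alone. *)
Lemma ambiguous_goal E h n tau :
  ambiguous E -> In (tick_fact tau) E ->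
  entails (qprog (machine_query h n) ++ map fact_rule E) (goal_atom tau).
Proof.
  intros [x [s [t [Hlt [Hs Ht]]]]] Htick Dom objc rel H ov tv.
  assert (Hnum : forall r, In r (num_rules ++ map fact_rule E) -> sat_rule Dom objc rel r).
  { intros r Hr. apply H. apply in_app_iff in Hr. apply in_app_iff.
    destruct Hr as [Hr | Hr]; [left | now right].
    (* The three leading rules are the input, goal and ambiguity rules. *)
    do 3 right. apply in_app_iff. now left. }
  apply (H ambiguity_rule ltac:(apply in_app_iff; left; simpl; auto)
    (fun _ => objc x) (fun i => match i with 0 => Z.of_nat t | _ => tau end)).
  intros b [<- | [<- | [<- | []]]].
  - apply (H (fact_rule (tick_fact tau))
      ltac:(apply in_app_iff; right; now apply in_map) ov tv).
    intros b [].
  - now apply (sat_num_rules Dom objc rel E Hnum).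
  - now apply (sat_above Dom objc rel E Hnum x s).
Qed.

(** The intended data, in which the object [i] is the numeral of the number [i] for [i <= B]. *)
Definition chain (B : nat) : dataset :=
  zero_fact 0 :: map (fun i => succ_fact i (S i)) (seq 0 B).

Lemma chain_numeral B E i : incl (chain B) E -> i <= B -> numeral E i i.
Proof.
  intros HE. induction i as [| i IH]; intros Hi.
  - apply numeral_zero, HE. now left.
  - apply numeral_succ with i; [| apply IH; lia]. apply HE. right.
    apply (in_map (fun i => succ_fact i (S i))). apply in_seq. lia.
Qed.

(** An arbitrary model of the rules becomes a closed [sem] by reading each number both as an object
    and as a time point; [derived_upto] then applies to it. *)
Lemma sat_clause_rules Dom objc rel B cs :
  (forall i, i <= B -> rel pNum [inl (objc i); inr (Z.of_nat i)]) ->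
  Forall clause_wf cs ->
  (forall c, In c cs -> sat_rule Dom objc rel (clause_rule c)) ->
  closed_upto B
    (fun R xs => rel (pRel R (length xs)) (map (fun x => inl (objc x)) xs)) cs.
Proof.
  intros Hnum Hwf H. apply Forall_forall. intros c Hc a Ha Hb.
  rewrite Forall_forall in Hwf. destruct (Hwf c Hc) as [_ Hbody].
  assert (Hhead : holds Dom objc rel (fun i => objc (a i)) (fun i => Z.of_nat (a i))
    (rel_atom (chead c) (cargs c))).
  { apply (H c Hc). intros b Hin. apply in_app_iff in Hin. destruct Hin as [Hin | Hin].
    - apply in_map_iff in Hin. destruct Hin as [i [<- Hi]]. apply in_seq in Hi.
      apply Hnum, Ha. lia.
    - apply in_map_iff in Hin. destruct Hin as [l [<- Hl]].
      rewrite Forall_forall in Hb, Hbody. specialize (Hb l Hl). specialize (Hbody l Hl).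
      destruct l as [x k | x y k | R xs]; unfold holds; simpl in *.
      + rewrite <- Hb. apply Hnum, Ha. now inversion Hbody.
      + rewrite <- Nat2Z.inj_add, <- Hb. apply Hnum, Ha. now inversion Hbody.
      + rewrite length_map, map_map in Hb. rewrite map_map. exact Hb. }
  unfold holds in Hhead. simpl in Hhead. rewrite map_map in Hhead.
  rewrite length_map, map_map. exact Hhead.
Qed.

(** The bound comes from the evaluation alone; the data may contain anything beyond the chain and
    the two ticks. *)
Lemma reval_goal h n :
  reval h [n] 0 ->
  exists B, forall E tau, incl (chain B) E -> In (tick_fact tau) E -> In (tick_fact (tau + 1)) E ->
    entails (qprog (machine_query h n) ++ map fact_rule E) (goal_atom tau).
Proof.
  intros Hh. destruct (reval_derived _ _ _ Hh) as [B HB]. exists B.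
  destruct (HB B (le_n B)) as [Hle Hder]. inversion_clear Hle as [| ? ? _ Hle'].
  inversion_clear Hle' as [| ? ? Hn _].
  intros E tau HE Htick Htick' Dom objc rel H ov tv.
  assert (Hsat : forall i, i <= B -> rel pNum [inl (objc i); inr (Z.of_nat i)]).
  { intros i Hi. apply (sat_num_rules Dom objc rel E); [| now apply chain_numeral with B].
    intros r Hr. apply H. apply in_app_iff in Hr. apply in_app_iff.
    destruct Hr as [Hr | Hr]; [left | now right].
    do 3 right. apply in_app_iff. now left. }
  apply (H (goal_rule h) ltac:(apply in_app_iff; left; simpl; auto)
    (fun i => match i with 0 => objc 0 | _ => objc n end)
    (fun i => match i with 0 => Z.of_nat n | _ => tau end)).
  intros b [<- | [<- | [<- | [<- | [<- | [<- | []]]]]]].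
  - apply (H (fact_rule (tick_fact tau))
      ltac:(apply in_app_iff; right; now apply in_map) ov tv).
    intros b [].
  - apply (H (fact_rule (tick_fact (tau + 1)))
      ltac:(apply in_app_iff; right; now apply in_map) ov tv).
    intros b [].
  - apply (H (input_rule n) ltac:(simpl; auto) ov tv). intros b [].
  - apply Hsat, Hn.
  - apply (Hsat 0). lia.
  - apply (Hder (fun R xs => rel (pRel R (length xs)) (map (fun x => inl (objc x)) xs))).
    apply sat_clause_rules; [exact Hsat | apply clauses_wf |].
    intros c Hc. apply H. apply in_app_iff. left. do 3 right. apply in_app_iff. right.
    now apply in_map.
Qed.

(** * Correctness of the reduction *)

Lemma tick_is_fact t : is_fact (tick_fact t) /\ pidb (apred (tick_fact t)) = false.
Proof.
  split; [split; [split; [reflexivity | right; apply temporal_time] |] | reflexivity].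
  repeat constructor.
Qed.

Lemma chain_dataset B : is_dataset (chain B).
Proof.
  assert (Hrigid : forall a, In a (chain B) -> rigid (apred a) /\ well_sorted a /\
            Forall ground_term (aargs a) /\ pidb (apred a) = false).
  { intros a [<- | Ha]; [| apply in_map_iff in Ha; destruct Ha as [i [<- _]]];
      repeat constructor. }
  apply Forall_forall. intros a Ha. destruct (Hrigid a Ha) as [Hr [Hs [Hg Hp]]].
  repeat split; auto.
Qed.

Lemma in_chain_rigid B a : In a (chain B) -> rigid (apred a).
Proof.
  intros [<- | Ha]; [| apply in_map_iff in Ha; destruct Ha as [i [<- _]]]; repeat constructor.
Qed.

Lemma tick_not_rigid t : ~ rigid (apred (tick_fact t)).
Proof. intros H. inversion H. discriminate. Qed.

(** Shows that the history used in [delay_fails] is unambiguous. *)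
Lemma numeral_chain_tick B t x m : numeral (chain B ++ [tick_fact t]) x m -> x = m.
Proof.
  induction 1 as [x H | x y m H _ IH]; apply in_app_iff in H; destruct H as [[H | H] | [H | []]];
    try discriminate H; [now injection H | |].
  - apply in_map_iff in H. destruct H as [i [H _]]. discriminate H.
  - apply in_map_iff in H. destruct H as [i [H _]]. injection H as <- <-. now f_equal.
Qed.

Lemma delay_fails h n : reval h [n] 0 -> ~ Delay (machine_query h n) 0.
Proof.
  intros Hh Hdelay. destruct (reval_goal h n Hh) as [B HB].
  assert (HD : is_dataset (chain B ++ [tick_fact 0])).
  { apply Forall_app. split; [apply chain_dataset |].
    constructor; [apply tick_is_fact | constructor]. }
  (* The history has the tick at 0; the update brings the second tick that the goal rule needs. *)
  destruct (Hdelay 0%Z (chain B ++ [tick_fact 0]) [tick_fact 1]) with (o := @nil nat) as [_ Hans].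
  - split; [exact HD |]. apply Forall_app. split.
    + apply Forall_forall. intros a Ha. left. now apply in_chain_rigid in Ha.
    + constructor; [| constructor]. right. split; [apply temporal_time |].
      exists [], 0%Z. split; [reflexivity | lia].
  - split; (constructor; [| constructor]); [apply tick_is_fact |].
    split; [apply temporal_time |]. exists [], 1%Z. split; [reflexivity | lia].
  - destruct Hans as [_ Hans].
    + split; [reflexivity |]. apply HB.
      * intros a Ha. rewrite !in_app_iff. auto.
      * rewrite !in_app_iff. simpl. auto.
      * rewrite !in_app_iff. simpl. auto.
    (* Without the update, the goal would require ambiguity, which the chain excludes, or a tick at
       1, which is absent. *)
    + apply goal_sound in Hans; [| exact HD]. destruct Hans as [_ Hans].
      destruct Hans as [Htick _].
      * intros [x [s [t [Hlt [Hs Ht]]]]].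
        apply numeral_chain_tick in Hs, Ht. lia.
      * apply in_app_iff in Htick. destruct Htick as [Htick | [Htick | []]].
        -- apply in_chain_rigid in Htick. now apply tick_not_rigid in Htick.
        -- discriminate Htick.
Qed.

(** Numerals arise from rigid facts only, and an update has none. *)
Lemma update_numeral tau D U x t :
  update tau U -> numeral (D ++ U) x t -> numeral D x t.
Proof.
  intros [_ HU] H. rewrite Forall_forall in HU.
  assert (Hrigid : forall a, rigid (apred a) -> In a (D ++ U) -> In a D).
  { intros a Hr Ha. apply in_app_iff in Ha. destruct Ha as [Ha | Ha]; [exact Ha |].
    destruct (HU a Ha) as [[l [Hl _]] _]. unfold rigid in Hr. rewrite Hl in Hr.
    apply Forall_app in Hr. destruct Hr as [_ Hr]. inversion Hr. discriminate. }
  induction H as [x Hx | x y t Hxy _ IH].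
  - apply numeral_zero, Hrigid; [repeat constructor | exact Hx].
  - apply numeral_succ with x; [| exact IH]. apply Hrigid; [repeat constructor | exact Hxy].
Qed.

Lemma delay_holds h n : ~ reval h [n] 0 -> Delay (machine_query h n) 0.
Proof.
  intros Hh tau D U [HD _] HU o. rewrite Z.sub_0_r. split; intros [Hlen Hans]; split; auto.
  (* Entailment is monotone in the data. *)
  - intros Dom objc rel H. apply (Hans Dom objc rel). intros r Hr. apply H.
    rewrite map_app, app_assoc. apply in_app_iff. now left.
  (* [pGoal] has only its time position, so the answer tuple is empty. *)
  - destruct o as [| o os]; [| discriminate Hlen].
    apply goal_sound in Hans; [| apply Forall_app; split; [exact HD | apply HU]].
    destruct Hans as [Htick Hans].
    apply ambiguous_goal.
    (* If the history were unambiguous, so would be the updated data, and the goal would force [h]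
       to map [n] to 0. *)
    + apply NNPP. intros Hamb. apply Hh. apply Hans. intros [x [s [t [Hlt [Hs Ht]]]]].
      apply Hamb. exists x, s, t.
      apply update_numeral with (tau := tau) in Hs, Ht; auto.
    (* Facts of the update lie strictly after [tau], so this tick belongs to the history. *)
    + apply in_app_iff in Htick. destruct Htick as [Htick | Htick]; [exact Htick |].
      destruct HU as [_ HU]. rewrite Forall_forall in HU.
      destruct (HU _ Htick) as [_ [l [z [Hl Hz]]]].
      apply (app_inj_tail [] l) in Hl. destruct Hl as [_ Hl]. injection Hl as <-. lia.
Qed.

(* [rinstance] maps [c] to the encoding of the instance whose query has goal [pGoal] and
   consists of [input_rule c] followed by the program with encoding [c]. *)
Definition rinput_rule : recf :=
  rComp rcp [rconst 0; rComp rcp [rconst (enc_pred pInput);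
    rComp rSucc [rComp rcp [rComp rcp [rconst 2; rComp rplus [rProj 0; rProj 0]]; rconst 0]]]].

Definition rinstance : recf :=
  rComp rcp [rComp rcp [rconst (enc_pred pGoal);
    rComp rSucc [rComp rcp [rinput_rule; rProj 0]]]; rconst 0].

(** The sum form matches the use of [rplus] in [rinput_rule]. *)
Lemma enc_Z_of_nat n : enc_Z (Z.of_nat n) = n + n.
Proof. destruct n; simpl; [reflexivity |]. rewrite SuccNat2Pos.id_succ. lia. Qed.

Lemma reval_input_rule n : reval rinput_rule [n] (enc_rule (input_rule n)).
Proof.
  unfold enc_rule, enc_atom, enc_term. simpl. rewrite enc_Z_of_nat.
  eapply reval_comp2; [apply reval_const | | apply reval_cp].
  eapply reval_comp2; [apply reval_const | | apply reval_cp].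
  eapply reval_comp1; [| apply reval_succ1].
  eapply reval_comp2; [| apply reval_const | apply reval_cp].
  eapply reval_comp2; [apply reval_const | | apply reval_cp].
  eapply reval_comp2; [apply ev_proj | apply ev_proj | apply reval_plus].
Qed.

Lemma reval_instance h :
  reval rinstance [enc_list enc_rule (base_program h)]
    (enc_instance (machine_query h (enc_list enc_rule (base_program h))) 0).
Proof.
  unfold enc_instance, machine_query. cbn [qpred qprog].
  set (c := enc_list enc_rule (base_program h)).
  (* Prepending a rule to an encoded program costs one pairing and one successor. *)
  change (enc_list enc_rule (input_rule c :: base_program h))
    with (S (cp (enc_rule (input_rule c)) c)).
  eapply reval_comp2; [| apply reval_const | apply reval_cp].
  eapply reval_comp2; [apply reval_const | | apply reval_cp].
  eapply reval_comp1; [| apply reval_succ1].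
  eapply reval_comp2; [apply reval_input_rule | apply (ev_proj 0 [c]) | apply reval_cp].
Qed.

Theorem theorem10 : ~ exists f : recf, decides_Delay f.
Proof.
  intros [f Hf].
  (* The diagonal function: on the code [c] of its own rules, [h] runs [f] on the instance in which
     [h] receives the input [c]. *)
  set (h := rComp f [rinstance]).
  set (c := enc_list enc_rule (base_program h)).
  destruct (Hf (machine_query h c) 0 (machine_query_temporal h c)) as [Hyes Hno].
  pose proof (reval_instance h) as Hinst. fold c in Hinst. clearbody c.
  (* If delay 0 held, [f] would answer 0, so [h] would map [c] to 0 and delay 0 would fail. *)
  assert (Hnot : ~ Delay (machine_query h c) 0).
  { intros Hd. apply (delay_fails h c); [| exact Hd].
    exact (reval_comp1 _ _ _ _ _ Hinst (Hyes Hd)). }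
  (* Now [f] answers 1, so [h] maps [c] to 1 and, by determinism, not to 0; hence delay 0 holds
     after all. *)
  apply Hnot, delay_holds. intros H0.
  pose proof (reval_comp1 _ _ _ _ _ Hinst (Hno Hnot) : reval h [c] 1) as H1.
  discriminate (reval_det _ _ _ H0 _ H1).
Qed.
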